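(* Let $K$ be a real valued field of characteristic zero and $f\in K\{x\}=K\{x_1,\dots,x_n\}$. Then $\mu(f)<\infty$ if and only if $\tau(f)<\infty$.
   Context: A real valued field is a field $K$ with a map $|\ |:K\to\mathbb{R}_{\ge 0}$ satisfying $|a|=0\Leftrightarrow a=0$, $|ab|=|a||b|$, $|a+b|\le|a|+|b|$ (the trivial valuation is allowed; $K$ need not be complete). For $x=(x_1,\dots,x_n)$, $K\{x\}\subseteq K[[x]]$ is the ring of convergent power series: those $f=\sum_\alpha c_\alpha x^\alpha$ for which $\sum_\alpha|c_\alpha|\varepsilon^\alpha<\infty$ for some $\varepsilon\in(\mathbb{R}_{>0})^n$. With $j(f)=\langle\frac{\partial f}{\partial x_1},\dots,\frac{\partial f}{\partial x_n}\rangle$, the Milnor number is $\mu(f)=\dim_KK\{x\}/j(f)$ and the Tjurina number is $\tau(f)=\dim_KK\{x\}/\langle f,j(f)\rangle$.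
   Formalization: The equivalence is proved for f with f(0)=0, and μ(f)<∞ ⇒ τ(f)<∞ for every f; without f(0)=0 the converse fails, e.g. f=1 with n≥1 has τ(f)=0 but μ(f)=∞. *)

(* Defs.v *)
From HB Require Import structures.
From mathcomp Require Import all_boot all_order all_algebra.
From mathcomp Require Import finmap boolp classical_sets functions cardinality.
From mathcomp Require Import fsbigop reals ereal esum.
From mathcomp Require Import ring lra.
From mathcomp Require mpoly.
(* The notations of mpoly are incompatible with those of mathcomp-analysis. *)
Import -(notations) mpoly.

Set Implicit Arguments.
Unset Strict Implicit.
Unset Printing Implicit Defensive.

Import Order.TTheory GRing.Theory Num.Theory.
Local Open Scope ring_scope.
Local Open Scope classical_set_scope.

Record absval (R : realType) (K : fieldType) := AbsVal {
  absv :> K -> R;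
  absv_ge0 : forall a, 0 <= absv a;
  absv_eq0 : forall a, absv a = 0 <-> a = 0;
  absvM : forall a b, absv (a * b) = absv a * absv b;
  absv_leD : forall a b, absv (a + b) <= absv a + absv b
}.

(* The formal power series ring K[[x_1, ..., x_n]]. *)
Record fps (n : nat) (K : Type) := Fps { fps_coef :> multinom n -> K }.

Section FormalPowerSeries.
Variables (n : nat) (K : fieldType).
Implicit Types (f g h : fps n K) (m : multinom n) (p q : mpoly n K).

HB.instance Definition _ := [isNew for @fps_coef n K].
HB.instance Definition _ := [Choice of fps n K by <:].

Lemma fpsP f g : (forall m, f m = g m) -> f = g.
Proof. by case: f g => f [g] /= fg; congr Fps; apply: funext. Qed.

Definition fps_add f g := Fps (fun m => f m + g m).
Definition fps_opp f := Fps (fun m => - f m).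
Definition fps_zero : fps n K := Fps (fun=> 0).

Fact fps_addA : associative fps_add.
Proof. by move=> f g h; apply: fpsP => m /=; rewrite addrA. Qed.
Fact fps_addC : commutative fps_add.
Proof. by move=> f g; apply: fpsP => m /=; rewrite addrC. Qed.
Fact fps_add0 : left_id fps_zero fps_add.
Proof. by move=> f; apply: fpsP => m /=; rewrite add0r. Qed.
Fact fps_addN : left_inverse fps_zero fps_opp fps_add.
Proof. by move=> f; apply: fpsP => m /=; rewrite addNr. Qed.

HB.instance Definition _ :=
  GRing.isZmodule.Build (fps n K) fps_addA fps_addC fps_add0 fps_addN.

(* Coefficientwise the same formula as mcoeffM for polynomials: the pairs
   (k1, k2) with k1 + k2 = m all lie in the displayed finite index type. *)
Definition fps_mul f g := Fps (fun m =>
  \sum_(k : bmultinom n (mdeg m).+1 * bmultinom n (mdeg m).+1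
         | m == mnm_add k.1 k.2) f k.1 * g k.2).
Definition fps_one : fps n K := Fps (fun m => (m == mnm0)%:R).

Definition fps_trunc (d : nat) f : mpoly n K :=
  \sum_(m : bmultinom n d) f m *: mpolyX K m.

Lemma mcoeff_fps_trunc d f m :
  (mdeg m < d)%N -> mcoeff m (fps_trunc d f) = f m.
Proof.
move=> md; rewrite /fps_trunc raddf_sum /= (bigD1 (BMultinom md)) //= big1.
  by rewrite mcoeffZ mcoeffX eqxx mulr1 addr0.
move=> k; rewrite -val_eqE /= => /negbTE km.
by rewrite mcoeffZ mcoeffX km mulr0.
Qed.

Lemma eq_mcoeffM d p p' q q' m : (mdeg m < d)%N ->
  (forall k, (mdeg k < d)%N -> mcoeff k p = mcoeff k p') ->
  (forall k, (mdeg k < d)%N -> mcoeff k q = mcoeff k q') ->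
  mcoeff m (p * q) = mcoeff m (p' * q').
Proof.
move=> md pp qq; rewrite !(mcoeff_poly_mul _ _ md).
by apply: eq_bigr => k _; rewrite pp ?qq ?bmdeg.
Qed.

Lemma fps_mulE d f g m : (mdeg m < d)%N ->
  fps_mul f g m = mcoeff m (fps_trunc d f * fps_trunc d g).
Proof.
move=> md; rewrite mcoeffM; apply: eq_bigr => k _.
by rewrite !mcoeff_fps_trunc // (leq_trans (bmdeg _)).
Qed.

Fact fps_mulA : associative fps_mul.
Proof.
move=> f g h; apply: fpsP => m.
rewrite !(fps_mulE _ _ (ltnSn (mdeg m))); set d := (mdeg m).+1.
transitivity (mcoeff m (fps_trunc d f * (fps_trunc d g * fps_trunc d h))).
  apply: (@eq_mcoeffM d) => // k kd.
  by rewrite mcoeff_fps_trunc // (fps_mulE _ _ kd).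
rewrite mulrA; apply: (@eq_mcoeffM d) => // k kd.
by rewrite mcoeff_fps_trunc // (fps_mulE _ _ kd).
Qed.

Fact fps_mulC : commutative fps_mul.
Proof.
by move=> f g; apply: fpsP => m; rewrite !(fps_mulE _ _ (ltnSn _)) mulrC.
Qed.

Fact fps_mul1 : left_id fps_one fps_mul.
Proof.
move=> f; apply: fpsP => m; rewrite (fps_mulE _ _ (ltnSn _)).
rewrite -[RHS](mcoeff_fps_trunc _ (ltnSn _)) -[X in _ = mcoeff _ X]mul1r.
apply: (@eq_mcoeffM (mdeg m).+1) => // k kd.
by rewrite mcoeff_fps_trunc //= mcoeff1.
Qed.

Fact fps_mulDl : left_distributive fps_mul +%R.
Proof.
move=> f g h; apply: fpsP => m /=; rewrite -big_split /=.
by apply: eq_bigr => k _; rewrite mulrDl.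
Qed.

Fact fps_one_neq0 : fps_one != 0.
Proof.
apply/eqP => /(congr1 (fun f : fps n K => f mnm0)) /= /eqP.
by rewrite eqxx oner_eq0.
Qed.

HB.instance Definition _ := GRing.Zmodule_isComNzRing.Build (fps n K)
  fps_mulA fps_mulC fps_mul1 fps_mulDl fps_one_neq0.

Definition fps_scale (a : K) f := Fps (fun m => a * f m).

Fact fps_scaleA a b f : fps_scale a (fps_scale b f) = fps_scale (a * b) f.
Proof. by apply: fpsP => m /=; rewrite mulrA. Qed.
Fact fps_scale1 : left_id 1 fps_scale.
Proof. by move=> f; apply: fpsP => m /=; rewrite mul1r. Qed.
Fact fps_scaleDr : right_distributive fps_scale +%R.
Proof. by move=> a f g; apply: fpsP => m /=; rewrite mulrDr. Qed.
Fact fps_scaleDl f : {morph fps_scale^~ f : a b / a + b}.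
Proof. by move=> a b; apply: fpsP => m /=; rewrite mulrDl. Qed.

HB.instance Definition _ := GRing.Zmodule_isLmodule.Build K (fps n K)
  fps_scaleA fps_scale1 fps_scaleDr fps_scaleDl.

Fact fps_scaleAl (a : K) f g : a *: (f * g) = (a *: f) * g.
Proof.
apply: fpsP => m /=; rewrite mulr_sumr.
by apply: eq_bigr => k _; rewrite mulrA.
Qed.

HB.instance Definition _ :=
  GRing.Lmodule_isLalgebra.Build K (fps n K) fps_scaleAl.

Definition fps_deriv (i : 'I_n) f : fps n K :=
  Fps (fun m => (m i).+1%:R * f (mnm_add m (mnm1 i))).

End FormalPowerSeries.

Section Convergence.
Variables (R : realType) (K : fieldType) (v : absval R K) (n : nat).
Implicit Types (f g : fps n K) (m : multinom n).

Definition convergent f := exists2 eps : 'I_n -> R, (forall i, 0 < eps i) &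
  (\esum_(m in [set: multinom n]) (v (f m) * \prod_i eps i ^+ m i)%:E < +oo)%E.

Lemma absv0 : v 0 = 0.
Proof. exact/absv_eq0. Qed.

Lemma absv1 : v 1 = 1.
Proof.
have v1 : v 1 != 0 by apply/eqP => /absv_eq0 /eqP; rewrite oner_eq0.
by apply: (mulfI v1); rewrite -absvM !mulr1.
Qed.

Lemma absv_nat k : v k%:R <= k%:R.
Proof.
elim: k => [|k IHk]; first by rewrite absv0.
rewrite -addn1 !natrD; apply: le_trans (absv_leD _ _ _) _.
by rewrite absv1 lerD2r.
Qed.

Lemma absv_sum (I : Type) (s : seq I) (P : pred I) (F : I -> K) :
  v (\sum_(i <- s | P i) F i) <= \sum_(i <- s | P i) v (F i).
Proof.
elim/big_rec2: _ => [|i y x _ le_xy]; first by rewrite absv0.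
by apply: le_trans (absv_leD _ _ _) _; rewrite lerD2l.
Qed.

Lemma bmultinom_leq_sum (F : multinom n -> R) (s : seq (multinom n)) d :
    (forall m, 0 <= F m) -> uniq s -> (forall m, m \in s -> (mdeg m < d)%N) ->
  \sum_(m <- s) F m <= \sum_(m : bmultinom n d) F m.
Proof.
move=> F0 us sd; rewrite -(big_map (@bmnm n d) xpredT F).
set t := map _ _; have ut : uniq t.
  by rewrite map_inj_uniq ?index_enum_uniq //; apply: val_inj.
have st : {subset s <= t}.
  move=> m /sd md; apply/mapP; exists (BMultinom md) => //.
  by rewrite mem_index_enum.
have -> : \sum_(m <- s) F m = \sum_(m <- t | m \in s) F m.
  rewrite -[RHS]big_filter; apply: perm_big; apply: uniq_perm => //.
    exact: filter_uniq.
  by move=> m; rewrite mem_filter; case: (boolP (m \in s)) => // /st ->.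
by rewrite [leRHS](bigID (fun m => m \in s)) /= lerDl sumr_ge0.
Qed.

Lemma convergentP f : convergent f <-> exists r M : R, [/\ 0 < r, 0 <= M &
  forall d, \sum_(m : bmultinom n d) v (f m) * r ^+ mdeg m <= M].
Proof.
split=> [[eps eps0]|[r [M [r0 M0 H]]]].
- set S := esum _ _ => Slt.
  pose F m := v (f m) * \prod_i eps i ^+ m i.
  have F0 m : 0 <= F m.
    by apply: mulr_ge0; [exact: absv_ge0|apply: prodr_ge0 => i _; rewrite exprn_ge0 ?ltW].
  have S0 : (0 <= S)%E by apply: esum_ge0 => m _; rewrite lee_fin F0.
  exists (\big[Num.min/1]_i eps i), (fine S).
  set r := \big[_/_]_i _.
  have r0 : 0 < r by rewrite /r; elim/big_ind: _ => // x y x0 y0; rewrite lt_min x0.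
  have reps i : r <= eps i.
    by rewrite /r (bigD1 i) //= ge_min lexx.
  split=> //; first exact: fine_ge0.
  move=> d; apply: (@le_trans _ _ (\sum_(m : bmultinom n d) F m)).
    apply: ler_sum => m _; apply: ler_wpM2l; first exact: absv_ge0.
    rewrite mdegE -prodrXr; apply: ler_prod => i _.
    apply/andP; split; first by rewrite exprn_ge0 ?ltW.
    by apply: lerXn2r; rewrite ?nnegrE ?reps // ltW.
  rewrite -lee_fin fineK ?ge0_fin_numE // -(big_map (@bmnm n d) xpredT F).
  set t := map _ _; have ut : uniq t.
    by rewrite map_inj_uniq ?index_enum_uniq //; apply: val_inj.
  rewrite -sumEFin fsbig_seq //; apply: ereal_sup_ubound.
  by exists [set` t] => //; split; [exact: finite_seq|exact: subsetT].
- exists (fun=> r) => //; apply: (@le_lt_trans _ _ M%:E); last exact: ltry.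
  apply: ge_ereal_sup => _ [A [finA _] <-].
  rewrite fsbig_finite //= sumEFin lee_fin.
  have E m : v (f m) * \prod_(i < n) r ^+ m i = v (f m) * r ^+ mdeg m.
    by rewrite mdegE -prodrXr.
  under eq_bigr do rewrite E.
  apply: le_trans (H (\max_(m <- fset_set A) mdeg m).+1).
  apply: bmultinom_leq_sum.
  + by move=> m; rewrite mulr_ge0 ?absv_ge0 ?exprn_ge0 ?ltW.
  + exact: fset_uniq.
  + by move=> m mA; rewrite ltnS; apply: leq_bigmax_seq.
Qed.

Definition conv_pred : {pred fps n K} := [pred f | `[< convergent f >]].

Lemma conv_predP f : reflect (convergent f) (f \in conv_pred).
Proof. exact: asboolP. Qed.

Lemma conv_weaken f r s M : 0 < s -> s <= r ->
  (forall d, \sum_(m : bmultinom n d) v (f m) * r ^+ mdeg m <= M) ->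
  forall d, \sum_(m : bmultinom n d) v (f m) * s ^+ mdeg m <= M.
Proof.
move=> s0 sr H d; apply: le_trans (H d); apply: ler_sum => m _.
apply: ler_wpM2l; first exact: absv_ge0.
by rewrite lerXn2r ?nnegrE // ltW // (lt_le_trans s0).
Qed.

Lemma conv2P f g : convergent f -> convergent g ->
  exists r M N : R, [/\ 0 < r, 0 <= M, 0 <= N,
   forall d, \sum_(m : bmultinom n d) v (f m) * r ^+ mdeg m <= M &
   forall d, \sum_(m : bmultinom n d) v (g m) * r ^+ mdeg m <= N].
Proof.
move=> /convergentP[r [M [r0 M0 HM]]] /convergentP[s [N [s0 N0 HN]]].
have t0 : 0 < Num.min r s by rewrite lt_min r0.
by exists (Num.min r s), M, N; split=> //;
   [apply: conv_weaken HM|apply: conv_weaken HN]; rewrite // ge_min lexx ?orbT.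
Qed.

Lemma conv_subsemialg_closed : GRing.subsemialg_closed conv_pred.
Proof.
have conv0 : convergent 0.
  apply/convergentP; exists 1, 0; split=> // d.
  by rewrite big1 // => m _; rewrite absv0 mul0r.
have convD f g : convergent f -> convergent g -> convergent (f + g).
  move=> cf cg; have [r [M [N [r0 M0 N0 HM HN]]]] := conv2P cf cg.
  apply/convergentP; exists r, (M + N); split=> //; first exact: addr_ge0.
  move=> d; apply: le_trans (lerD (HM d) (HN d)); rewrite -big_split /=.
  apply: ler_sum => m _; rewrite -mulrDl; apply: ler_wpM2r; last exact: absv_leD.
  by rewrite exprn_ge0 ?ltW.
split.
- apply/conv_predP/convergentP; exists 1, 1; split=> // d.
  case: d => [|d].
    by rewrite big1 // => m; have := bmdeg m; rewrite ltn0.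
  have z : (mdeg (mnm0 : multinom n) < d.+1)%N by rewrite mdeg0.
  rewrite (bigD1 (BMultinom z)) //= big1; first by rewrite eqxx absv1 expr1n mulr1 addr0.
  by move=> m; rewrite -val_eqE /= => /negbTE ->; rewrite absv0 mul0r.
- split; first exact/conv_predP.
  by move=> f g /conv_predP cf /conv_predP cg; apply/conv_predP/convD.
- move=> a f /conv_predP /convergentP[r [M [r0 M0 H]]].
  apply/conv_predP/convergentP; exists r, (v a * M).
  split=> //; first by rewrite mulr_ge0 ?absv_ge0.
  move=> d; apply: le_trans (ler_wpM2l (absv_ge0 v a) (H d)).
  rewrite mulr_sumr; apply: ler_sum => m _.
  by rewrite absvM mulrA.
- move=> f g /conv_predP cf /conv_predP cg.
  have [r [M [N [r0 M0 N0 HM HN]]]] := conv2P cf cg.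
  apply/conv_predP/convergentP; exists r, (M * N); split=> //; first exact: mulr_ge0.
  move=> d; apply: (@le_trans _ _ (\sum_(m : bmultinom n d)
    \sum_(k : bmultinom n d * bmultinom n d | bmnm m == mnm_add k.1 k.2)
      (v (f k.1) * r ^+ mdeg k.1) * (v (g k.2) * r ^+ mdeg k.2))).
    apply: ler_sum => m _.
    rewrite [f * g]/(fps_mul f g) (fps_mulE _ _ (bmdeg m)).
    rewrite (mcoeff_poly_mul _ _ (bmdeg m)).
    apply: le_trans (ler_wpM2r (exprn_ge0 _ (ltW r0)) (absv_sum _ _ _)) _.
    rewrite mulr_suml; apply: ler_sum => k /eqP ->.
    rewrite mdegD exprD absvM !mcoeff_fps_trunc ?bmdeg //.
    by rewrite mulrACA.
  apply: (@le_trans _ _ (\sum_(k : bmultinom n d * bmultinom n d)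
      (v (f k.1) * r ^+ mdeg k.1) * (v (g k.2) * r ^+ mdeg k.2))).
    rewrite (exchange_big_dep xpredT) //=; apply: ler_sum => k _.
    set x := (_ * _ * _).
    have x0 : 0 <= x by rewrite !mulr_ge0 ?absv_ge0 ?exprn_ge0 ?ltW.
    have [m /eqP mk|no] := pickP (fun m : bmultinom n d => bmnm m == mnm_add k.1 k.2).
      rewrite (big_pred1 m) // => m' /=.
      by rewrite -mk -val_eqE.
    by rewrite big_pred0.
  rewrite -(pair_bigA _ (fun i j : bmultinom n d => (v (f i) * r ^+ mdeg i) *
     (v (g j) * r ^+ mdeg j))) /= -big_distrlr /=.
  by apply: ler_pM (HM d) (HN d); apply: sumr_ge0 => m _;
     rewrite mulr_ge0 ?absv_ge0 ?exprn_ge0 ?ltW.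
Qed.

HB.instance Definition _ :=
  GRing.isSubalgClosed.Build K (fps n K) conv_pred conv_subsemialg_closed.

Lemma convergent_deriv (i : 'I_n) f :
  convergent f -> convergent (fps_deriv i f).
Proof.
move=> /convergentP[r [M [r0 M0 H]]]; apply/convergentP.
exists (r / 2), (r^-1 * M).
split; first exact: divr_gt0.
  by rewrite mulr_ge0 // invr_ge0 ltW.
move=> d; apply: le_trans (ler_wpM2l _ (H d.+1)); last by rewrite invr_ge0 ltW.
pose F m := v (f m) * r ^+ mdeg m.
have F0 m : 0 <= F m by rewrite mulr_ge0 ?absv_ge0 ?exprn_ge0 ?ltW.
pose s := [seq mnm_add (bmnm m) (mnm1 i) | m : bmultinom n d].
apply: (@le_trans _ _ (r^-1 * \sum_(m <- s) F m)).
  rewrite big_image mulr_sumr; apply: ler_sum => m _.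
  rewrite /F /= mdegD mdeg1 addn1 absvM exprS.
  rewrite [leRHS](_ : _ = v (f (mnm_add m (mnm1 i))) * r ^+ mdeg m); last first.
    by field; rewrite gt_eqF.
  rewrite expr_div_n [in leLHS]mulrAC mulrC; apply: ler_wpM2l; first exact: absv_ge0.
  apply: (@le_trans _ _ ((m i).+1%:R * (r ^+ mdeg m / 2 ^+ mdeg m))).
    apply: ler_wpM2r; last exact: absv_nat.
    by rewrite divr_ge0 ?exprn_ge0 ?ltW.
  rewrite mulrCA -[leRHS]mulr1; apply: ler_wpM2l.
    by rewrite exprn_ge0 ?ltW.
  rewrite ler_pdivrMr ?exprn_gt0 // mul1r -natrX ler_nat.
  apply: leq_trans (ltn_expl (m i) (ltnSn 1)) _.
  by rewrite leq_exp2l // mdegE (bigD1 i) //= leq_addr.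
apply: ler_wpM2l; first by rewrite invr_ge0 ltW.
apply: bmultinom_leq_sum => //.
  rewrite map_inj_uniq ?enum_uniq // => m m' /addIm mm; exact: val_inj.
by move=> _ /mapP[m _ ->]; rewrite mdegD mdeg1 addn1 ltnS bmdeg.
Qed.

End Convergence.

Arguments conv_pred {R K} v n.

(* The ring K{x_1, ..., x_n} of convergent power series. *)
Record cps (R : realType) (K : fieldType) (v : absval R K) (n : nat) :=
  Cps { cps_val :> fps n K; _ : cps_val \in conv_pred v n }.

Section ConvergentPowerSeries.
Variables (R : realType) (K : fieldType) (v : absval R K) (n : nat).

HB.instance Definition _ := [isSub for @cps_val R K v n].
HB.instance Definition _ := [Choice of cps v n by <:].
HB.instance Definition _ := [SubChoice_isSubComNzRing of cps v n by <:].
HB.instance Definition _ :=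
  [SubZmodule_isSubLmodule of cps v n by <:].
HB.instance Definition _ :=
  [SubNzRing_SubLmodule_isSubLalgebra of cps v n by <:].

Fact cps_deriv_subproof (i : 'I_n) (f : cps v n) :
  fps_deriv i f \in conv_pred v n.
Proof.
by apply/conv_predP/convergent_deriv/conv_predP; exact: (valP f).
Qed.

Definition cps_deriv (i : 'I_n) (f : cps v n) : cps v n :=
  Cps (cps_deriv_subproof i f).

Definition jacobian (f : cps v n) : seq (cps v n) :=
  [seq cps_deriv i f | i <- enum 'I_n].

End ConvergentPowerSeries.

Definition ideal_gen (A : comNzRingType) (s : seq A) : set A :=
  [set h | exists c : 'I_(size s) -> A, h = \sum_i c i * s`_i].

(* Families of V whose classes in V / U are linearly independent. *)
Definition free_mod (K : fieldType) (V : lmodType K) (U : set V) (m : nat)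
    (g : 'I_m -> V) :=
  forall a : 'I_m -> K, U (\sum_i a i *: g i) -> forall i, a i = 0.

(* dim_K (V / U), with value +oo when V / U is infinite dimensional. *)
Definition dim_quot (R : realType) (K : fieldType) (V : lmodType K)
    (U : set V) : \bar R :=
  ereal_sup [set m%:R%:E | m in
    [set m : nat | exists g : 'I_m -> V, free_mod U g]].

Section MilnorTjurina.
Variables (R : realType) (K : fieldType) (v : absval R K) (n : nat).

Definition milnor (f : cps v n) : \bar R :=
  dim_quot R (ideal_gen (jacobian f)).

Definition tjurina (f : cps v n) : \bar R :=
  dim_quot R (ideal_gen (f :: jacobian f)).

Definition value0 (f : cps v n) : K := f (@mnm0 n).

End MilnorTjurina.

(* Main.v *)
Require Import Defs.
From HB Require Import structures.
From mathcomp Require Import all_boot all_order all_algebra.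
From mathcomp Require Import boolp classical_sets.
From mathcomp Require Import reals constructive_ereal ereal.
From mathcomp Require Import ring lra zify.
From mathcomp Require mpoly.
Import -(notations) mpoly.

Set Implicit Arguments.
Unset Strict Implicit.
Unset Printing Implicit Defensive.

Import Order.TTheory GRing.Theory Num.Theory.
Local Open Scope ring_scope.

(** Let [J] be the ideal of the partial derivatives of [f]. A family that is
    free modulo [J + (f)] is free modulo [J], so a finite Milnor number bounds
    the Tjurina number. Conversely let [B] be the quotient by [J], suppose that
    [B / f B] has finite dimension and that [f] has no constant term. If [f] is
    nilpotent in [B], then the quotients [f^N B / f^(N+1) B] are finitely many
    non-zero spaces of dimension at most that of [B / f B], and [B] has finite
    dimension. So everything rests on the nilpotence of [f] in [B], the
    algebraic form of the fact that a function germ is constant along any curve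
    contained in its critical locus.

    Multiplication by [f] maps [f^N B / f^(N+1) B] onto the next quotient, so
    their dimensions are eventually equal to some [e] ([stable_level]). If
    [e = 0], then [f^N (1 - f c) = 0] in [B] for some [c], and [1 - f c] is
    invertible, so [f^N = 0]. If [e > 0], then [M = f^N B / f^(N+2) B] is a free
    module of rank [e] over the dual numbers [K[t] / t^2], with [t] acting as
    [f]. A series [g] thus acts on [M] by a matrix [rho g + t delta g], where
    [rho] is multiplicative and [delta] satisfies Leibniz's rule
    ([acts_byM]). The chain rule fails for [delta], because [rho x_i] and
    [delta x_j] need not commute, but it holds after taking traces
    ([trace_delta]):
      [tr (delta g) = sum_i tr (rho (d_i g) * delta x_i)].
    It is checked on monomials, and the general case follows because a large
    power of each coordinate acts as [0] under [rho], so that [g] may be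
    replaced by a polynomial. For [g = f] the right-hand side is [0], since
    [d_i f] belongs to [J], while [delta f] is the identity matrix, of trace
    [e]; in characteristic zero this is a contradiction ([stable_rank0]).

    The argument needs only an algebra with a residue map, coordinates, partial
    derivatives and a division by powers of the coordinates. For convergent
    series over a field that need not be complete, these are elementary:
    inverses come from the geometric series, whose convergence follows from
    the submultiplicativity of the weighted norm ([convergent_geometric]), and
    division groups the monomials by a variable with a large exponent
    ([cps_division]). *)

(** * Dimension of a quotient space *)

Section QuotientDimension.
Variables (K : fieldType) (V : lmodType K) (U : set V).

Definition is_subspace := U 0 /\ forall a x y, U x -> U y -> U (a *: x + y).

Hypothesis subU : is_subspace.

Lemma subspace_lincomb (I : Type) (r : seq I) (a : I -> K) (x : I -> V) :
  (forall i, U (x i)) -> U (\sum_(i <- r) a i *: x i).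
Proof.
case: subU => U0 UL Ux.
by elim: r => [|i r IHr]; rewrite ?big_nil // big_cons; apply: UL.
Qed.

Lemma free_mod_leq_span D (h : 'I_D -> V) m (g : 'I_m -> V) :
    (forall x, exists a : 'I_D -> K, U (x - \sum_i a i *: h i)) ->
  free_mod U g -> (m <= D)%N.
Proof.
move=> spanh freeg; rewrite leqNgt; apply/negP => ltDm.
have /choice[a Ha] := spanh.
(* A relation between the coordinate rows of the g i, which are more numerous
   than their entries, is a relation between the g i modulo U. *)
pose M : 'M[K]_(m, D) := \matrix_(i, k) a (g i) k.
have : kermx M != 0.
  rewrite kermx_eq0 -row_leq_rank -ltnNge.
  exact: leq_ltn_trans (rank_leq_col M) ltDm.
case/rowV0Pn => c /sub_kermxP cM0 /eqP[].
apply/rowP => i; rewrite mxE; move: i; apply: freeg.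
have -> : \sum_i c 0 i *: g i = \sum_i c 0 i *: (g i - \sum_k a (g i) k *: h k).
  under [RHS]eq_bigr do rewrite scalerBr.
  rewrite sumrB [X in _ - X](_ : _ = 0) ?subr0 //.
  under eq_bigr do rewrite scaler_sumr.
  rewrite exchange_big big1 //= => k _.
  under eq_bigr do rewrite scalerA.
  have := congr1 (fun B : 'rV_D => B 0 k) cM0; rewrite !mxE.
  rewrite -scaler_suml => c0.
  rewrite (eq_bigr (fun j => c 0 j * M j k)) ?c0 ?scale0r // => j _.
  by rewrite mxE.
exact: subspace_lincomb.
Qed.

(** A family of maximal size among the free families taken from [W] spans
    [W] modulo [U]: otherwise one more vector could be adjoined. *)
Lemma maximal_free_spans (W : set V) m (g : 'I_m -> V) :
    (forall i, W (g i)) -> free_mod U g ->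
    (forall g' : 'I_m.+1 -> V, (forall i, W (g' i)) -> ~ free_mod U g') ->
  forall x, W x -> exists a : 'I_m -> K, U (x - \sum_i a i *: g i).
Proof.
case: subU => U0 UL Wg freeg maxg x Wx.
pose g' i := if unlift ord0 i is Some j then g j else x.
have Wg' i : W (g' i) by rewrite /g'; case: unliftP.
have /existsNP[a] := maxg g' Wg'.
move=> /not_implyP[Ua /existsNP[i /eqP nzai]].
have sumE : \sum_i a i *: g' i = a ord0 *: x + \sum_j a (lift ord0 j) *: g j.
  rewrite big_ord_recl /g' unlift_none; congr (_ + _).
  by apply: eq_bigr => j _; rewrite liftK.
have nza0 : a ord0 != 0.
  apply: contraNneq nzai => a0; move: Ua.
  rewrite sumE a0 scale0r add0r => /freeg aj.
  by case: (unliftP ord0 i) => [j ->|->]; rewrite ?aj ?a0.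
exists (fun j => - (a ord0)^-1 * a (lift ord0 j)).
have := UL (a ord0)^-1 _ 0 Ua U0.
rewrite addr0 sumE scalerDr scalerA mulVf // scale1r scaler_sumr.
congr (U (_ + _)); rewrite -sumrN; apply: eq_bigr => j _.
by rewrite scalerA mulNr scaleNr opprK.
Qed.

End QuotientDimension.

Lemma free_mod_subset (K : fieldType) (V : lmodType K) (U U' : set V) m
    (g : 'I_m -> V) :
  (forall x, U x -> U' x) -> free_mod U' g -> free_mod U g.
Proof. by move=> sUU' freeg a Ua; apply: freeg; apply: sUU'. Qed.

Lemma dim_quot_lty (R : realType) (K : fieldType) (V : lmodType K)
    (U : set V) :
  (dim_quot R U < +oo)%E <->
  exists D, forall m (g : 'I_m -> V), free_mod U g -> (m <= D)%N.
Proof.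
split=> [fin|[D leD]]; last first.
  apply: (@le_lt_trans _ _ D%:R%:E); last exact: ltry.
  apply: ge_ereal_sup => _ [m [g freeg] <-].
  by rewrite lee_fin ler_nat; apply: leD freeg.
have [r ler] : exists r : R, forall m (g : 'I_m -> V), free_mod U g ->
    m%:R <= r.
  exists (fine (dim_quot R U)) => m g freeg.
  have le_m : (m%:R%:E <= dim_quot R U)%E.
    by apply: ereal_sup_ubound; exists m => //; exists g.
  rewrite -lee_fin fineK //; apply/fin_real.
  by rewrite fin andbT; apply: lt_le_trans le_m; exact: ltNyr.
exists (Num.truncn r).+1 => m g /ler lemr.
rewrite -(ler_nat R) (le_trans lemr) //.
by apply/ltW; rewrite truncnS_gt.
Qed.

(** * The action on a module over the dual numbers *)

Section Ideals.
Variables (K : fieldType) (A : comAlgType K).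
Implicit Types (I : set A) (x y : A).

Definition is_ideal I :=
  [/\ I 0, forall x y, I x -> I y -> I (x + y) & forall a x, I x -> I (a * x)].

Lemma ideal_subspace I : is_ideal I -> is_subspace I.
Proof.
move=> [I0 ID IM]; split=> // a x y Ix Iy; apply: ID => //.
by rewrite -[x]mul1r scalerAl; apply: IM.
Qed.

Lemma idealB I x y : is_ideal I -> I x -> I y -> I (x - y).
Proof. by move=> [_ ID IM] Ix Iy; apply: ID; rewrite // -mulN1r; apply: IM. Qed.

End Ideals.

Section FirstOrderAction.
Variables (K : fieldType) (A : comAlgType K) (U : set A) (e : nat).
Variables (w : 'I_e -> A) (f : A).

Definition rowcomb (M : 'M[K]_e) i : A := \sum_k M i k *: w k.

(** The matrix of multiplication by [g] on the family [w], modulo [U], is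
    [P + f Q]: a matrix over the dual numbers, with [f] as infinitesimal. *)
Definition acts_by g P Q :=
  forall i, U (g * w i - (rowcomb P i + f * rowcomb Q i)).

Hypothesis idU : is_ideal U.
Hypothesis f2w : forall i, U (f * f * w i).
Hypothesis freew : forall p q : 'I_e -> K,
  U (\sum_k p k *: w k + f * \sum_k q k *: w k) ->
  forall k, p k = 0 /\ q k = 0.

Lemma rowcombD M N i : rowcomb (M + N) i = rowcomb M i + rowcomb N i.
Proof.
by rewrite -big_split; apply: eq_bigr => k _; rewrite mxE scalerDl.
Qed.

Lemma rowcombZ a M i : rowcomb (a *: M) i = a *: rowcomb M i.
Proof.
by rewrite scaler_sumr; apply: eq_bigr => k _; rewrite mxE scalerA.
Qed.

Lemma acts_by_unique g P Q P' Q' :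
  acts_by g P Q -> acts_by g P' Q' -> P = P' /\ Q = Q'.
Proof.
move=> gPQ gPQ'.
have E i k : P i k - P' i k = 0 /\ Q i k - Q' i k = 0.
  apply: (freew (p := fun k => P i k - P' i k) (q := fun k => Q i k - Q' i k)).
  have := idealB idU (gPQ' i) (gPQ i); congr (U _).
  under [in RHS]eq_bigr do rewrite scalerBl.
  under [X in _ = _ + f * X]eq_bigr do rewrite scalerBl.
  by rewrite !sumrB -!/(rowcomb _ _); ring.
by split; apply/matrixP => i k; apply: subr0_eq; case: (E i k).
Qed.

Lemma acts_byD g h P Q P' Q' : acts_by g P Q -> acts_by h P' Q' ->
  acts_by (g + h) (P + P') (Q + Q').
Proof.
move=> gPQ hPQ i; have [_ UD _] := idU.
by have := UD _ _ (gPQ i) (hPQ i); congr (U _); rewrite !rowcombD; ring.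
Qed.

Lemma acts_byZ a g P Q : acts_by g P Q ->
  acts_by (a *: g) (a *: P) (a *: Q).
Proof.
move=> gPQ i; have [U0 UL] := ideal_subspace idU.
have := UL a _ _ (gPQ i) U0; congr (U _).
by rewrite addr0 !rowcombZ scalerBr scalerDr -scalerAl -scalerAr.
Qed.

Lemma rowcomb0 i : rowcomb 0 i = 0.
Proof. by rewrite /rowcomb big1 // => k _; rewrite mxE scale0r. Qed.

Lemma rowcomb1 i : rowcomb 1%:M i = w i.
Proof.
rewrite /rowcomb (bigD1 i) //= big1 => [|k /negbTE ki].
  by rewrite mxE eqxx scale1r addr0.
by rewrite mxE eq_sym ki scale0r.
Qed.

Lemma acts_by1 : acts_by 1 1%:M 0.
Proof.
move=> i; have [U0 _ _] := idU; congr (U _): U0.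
by rewrite rowcomb0 rowcomb1; ring.
Qed.

Lemma acts_by_self : acts_by f 0 1%:M.
Proof.
move=> i; have [U0 _ _] := idU; congr (U _): U0.
by rewrite rowcomb0 rowcomb1; ring.
Qed.

Lemma acts_by_ideal g : U g -> acts_by g 0 0.
Proof.
move=> Ug i; have [_ _ UM] := idU; have := UM (w i) _ Ug; congr (U _).
by rewrite rowcomb0; ring.
Qed.

(** The rule of multiplication of dual numbers: as [f * f] kills every [w i],
    no second-order term remains, the first component is multiplicative and the
    second one obeys Leibniz's rule. *)
Lemma acts_byM g h P Q P' Q' : acts_by g P Q -> acts_by h P' Q' ->
  acts_by (g * h) (P' *m P) (P' *m Q + Q' *m P).
Proof.
move=> gPQ hPQ i; have [_ UD UM] := idU; have subU := ideal_subspace idU.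
have rowcombM M N k : rowcomb (M *m N) k = \sum_l M k l *: rowcomb N l.
  under [RHS]eq_bigr do rewrite scaler_sumr.
  rewrite exchange_big; apply: eq_bigr => l _.
  under [RHS]eq_bigr do rewrite scalerA.
  by rewrite mxE scaler_suml.
have gM M : U (g * rowcomb M i - (rowcomb (M *m P) i + f * rowcomb (M *m Q) i)).
  have := subspace_lincomb subU (index_enum 'I_e) (M i) gPQ.
  congr (U _); under eq_bigr do rewrite scalerBr scalerDr.
  rewrite sumrB big_split /= !rowcombM !mulr_sumr.
  by congr (_ - (_ + _)); apply: eq_bigr => k _; rewrite scalerAr.
have f2 : U (f * f * rowcomb (Q' *m Q) i).
  have := subspace_lincomb subU (index_enum 'I_e) ((Q' *m Q) i) f2w.
  by congr (U _); rewrite mulr_sumr; apply: eq_bigr => k _; rewrite scalerAr.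
have := UD _ _ (UD _ _ (UM g _ (hPQ i)) (gM P'))
               (UD _ _ (UM f _ (gM Q')) f2).
by congr (U _); rewrite !rowcombD; ring.
Qed.

End FirstOrderAction.

(** * The trace formula *)

Section TraceFormula.
Variables (K : fieldType) (A : comAlgType K) (n : nat).
Variables (X : 'I_n -> A) (d : 'I_n -> A -> A) (val : A -> K).

Definition is_derivation (D : A -> A) :=
  (forall a x y, D (a *: x + y) = a *: D x + D y) /\
  (forall x y, D (x * y) = D x * y + x * D y).

Definition is_residue_map :=
  [/\ forall a x y, val (a *: x + y) = a * val x + val y,
      forall x y, val (x * y) = val x * val y, val 1 = 1 &
      forall x, val x != 0 -> exists y, x * y = 1].

(** The remainder of the division by the [s]-th powers of all the coordinates
    is a polynomial. *)
Definition divides_with_remainder := forall s g,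
  exists (r : seq (multinom n)) (c : multinom n -> K) (h : 'I_n -> A),
    g = \sum_(m <- r) c m *: \prod_i X i ^+ m i + \sum_k X k ^+ s * h k.

Hypothesis dd : forall i, is_derivation (d i).
Hypothesis dX : forall i k, d i (X k) = (i == k)%:R.
Hypothesis valP : is_residue_map.
Hypothesis valX : forall k, val (X k) = 0.
Hypothesis divX : divides_with_remainder.

Variables (e : nat) (rho delta : A -> 'M[K]_e.+1).
Hypothesis rhoL : forall a x y, rho (a *: x + y) = a *: rho x + rho y.
Hypothesis deltaL : forall a x y, delta (a *: x + y) = a *: delta x + delta y.
Hypothesis rho1 : rho 1 = 1%:M.
Hypothesis rhoM : forall x y, rho (x * y) = rho y *m rho x.
Hypothesis deltaM :
  forall x y, delta (x * y) = rho y *m delta x + delta y *m rho x.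

Lemma rhoX x s : rho (x ^+ s) = rho x ^+ s.
Proof. by elim: s => [|s IHs]; rewrite ?rho1 // exprSr rhoM IHs exprS. Qed.

Lemma rho0 : rho 0 = 0.
Proof.
have := rhoL (-1) 0 0.
by rewrite scaler0 addr0 scaleN1r addNr.
Qed.

(** Write the characteristic polynomial of [rho x] as ['X^s * q] with
    [q.[0] != 0]: then [q] evaluated at [x] is a unit, so the Cayley-Hamilton
    theorem leaves [rho x ^+ s = 0]. *)
Lemma rho_nilpotent x : val x = 0 -> exists s, rho (x ^+ s) = 0.
Proof.
move=> x0; have [valL valM val1 val_unit] := valP.
(* The evaluation of q at x is built along with its image and its residue. *)
have horner_rho (q : {poly K}) :
    exists2 y, rho y = horner_mx (rho x) q & val y = q.[0].
  elim/poly_ind: q => [|q c [y rho_y val_y]].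
    exists 0; first by rewrite rho0 rmorph0.
    have := valL (-1) 0 0.
    by rewrite scaler0 addr0 mulN1r addNr horner0.
  exists (c *: 1 + y * x).
    rewrite rhoL rho1 rhoM rho_y rmorphD rmorphM /= horner_mx_X horner_mx_C.
    rewrite addrC scalemx1; congr (_ + _).
    by apply: esym; apply: comm_horner_mx; exact: comm_mx_refl.
  by rewrite valL val1 valM x0 mulr0 mulr1 addr0 !hornerE.
have [s [q /implyP nzq charE]] := multiplicity_XsubC (char_poly (rho x)) 0.
have {}nzq : ~~ root q 0 by apply: nzq; rewrite monic_neq0 ?char_poly_monic.
have [y rho_y val_y] := horner_rho q.
have [z yz1] : exists z, y * z = 1 by apply: val_unit; rewrite val_y.
exists s; have := Cayley_Hamilton (rho x).
rewrite charE subr0 rmorphM rmorphXn /= horner_mx_X -rho_y => yx0.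
have := congr1 (mulmx (rho z)) yx0.
by rewrite mulmx0 mulmxA -rhoM yz1 rho1 mul1mx rhoX.
Qed.

(** The extra factor [a] makes the vanishing of the defect stable under
    products. *)
Definition trace_defect a x :=
  \tr (rho a *m delta x) - \sum_i \tr (rho (a * d i x) *m delta (X i)).

Lemma trace_defectL a b x y :
  trace_defect a (b *: x + y) = b * trace_defect a x + trace_defect a y.
Proof.
rewrite /trace_defect deltaL mulmxDr -scalemxAr mxtraceD mxtraceZ.
rewrite mulrBr addrACA -opprD; congr (_ - _).
rewrite mulr_sumr -big_split; apply: eq_bigr => i _; have [dL _] := dd i.
by rewrite dL mulrDr -scalerAr rhoL mulmxDl mxtraceD -scalemxAl mxtraceZ.
Qed.

(** Invariance of the trace under cyclic permutations replaces the commutation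
    of [delta y] with [rho x], which may fail. *)
Lemma trace_defectM a x y :
  trace_defect a (x * y) = trace_defect (a * y) x + trace_defect (a * x) y.
Proof.
rewrite /trace_defect deltaM mulmxDr mxtraceD addrACA -opprD.
rewrite mulmxA -rhoM [y * a]mulrC.
have -> : \tr (rho a *m (delta y *m rho x)) = \tr (rho (a * x) *m delta y).
  by rewrite mulmxA mxtrace_mulC mulmxA -rhoM.
congr (_ - _).
rewrite -big_split; apply: eq_bigr => i _; have [_ dM] := dd i.
rewrite dM /= -mxtraceD -mulmxDl -[rho (a * y * d i x)]scale1r -rhoL scale1r.
by congr (\tr (rho _ *m _)); ring.
Qed.

Lemma trace_defect_lincomb a (I : Type) (r : seq I) (c : I -> K) (x : I -> A) :
  (forall i, trace_defect a (x i) = 0) ->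
  trace_defect a (\sum_(i <- r) c i *: x i) = 0.
Proof.
move=> x0; elim: r => [|i r IHr]; last first.
  by rewrite big_cons trace_defectL x0 mulr0 add0r.
have := trace_defectL a (-1) 0 0.
by rewrite big_nil scaler0 addr0 mulN1r addNr.
Qed.

Lemma trace_defect1 a : trace_defect a 1 = 0.
Proof.
have := trace_defectM a 1 1.
by rewrite !mulr1 => /eqP; rewrite -subr_eq0 opprD addNKr oppr_eq0 => /eqP.
Qed.

Lemma trace_defect_coord a k : trace_defect a (X k) = 0.
Proof.
rewrite /trace_defect (bigD1 k) //= dX eqxx mulr1 big1 ?addr0 ?subrr // => i.
by move=> /negbTE ik; rewrite dX ik mulr0 rho0 mul0mx mxtrace0.
Qed.

Lemma trace_defect_exp a k s : trace_defect a (X k ^+ s) = 0.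
Proof.
elim: s a => [|s IHs] a; first exact: trace_defect1.
by rewrite exprS trace_defectM IHs trace_defect_coord addr0.
Qed.

Lemma trace_defect_monomial a (m : multinom n) :
  trace_defect a (\prod_i X i ^+ m i) = 0.
Proof.
elim/big_ind: _ a => [a|x y x0 y0 a|i _ a]; first exact: trace_defect1.
  by rewrite trace_defectM x0 y0 addr0.
exact: trace_defect_exp.
Qed.

(** The chain rule under the trace: it holds for monomials in the coordinates,
    and the remaining terms of [x] carry a power of a coordinate that acts as
    zero. *)
Lemma trace_delta x :
  \tr (delta x) = \sum_i \tr (rho (d i x) *m delta (X i)).
Proof.
apply/eqP; rewrite -subr_eq0; apply/eqP.
transitivity (trace_defect 1 x).
  by rewrite /trace_defect rho1 mul1mx; under [in RHS]eq_bigr do rewrite mul1r.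
have /choice[s sP] : forall k, exists s, rho (X k ^+ s) = 0.
  by move=> k; apply: rho_nilpotent.
pose t := \max_k s k.
have rhoXt k : rho (X k ^+ t) = 0.
  by rewrite -(subnK (leq_bigmax k : (s k <= t)%N)) exprD rhoM sP mul0mx.
have [r [c [h ->]]] := divX t x.
rewrite -[X in X + _]scale1r trace_defectL mul1r.
rewrite trace_defect_lincomb => [|m]; last exact: trace_defect_monomial.
rewrite add0r; under eq_bigr do rewrite -[_ * _]scale1r.
apply: trace_defect_lincomb => k.
rewrite trace_defectM trace_defect_exp add0r mul1r.
rewrite /trace_defect rhoXt mul0mx mxtrace0 big1 ?subr0 // => i _.
by rewrite rhoM rhoXt mulmx0 mul0mx mxtrace0.
Qed.

End TraceFormula.

(** * Finite colength and nilpotence *)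

Section FiniteColength.
Variables (K : fieldType) (A : comAlgType K) (n : nat).
Variables (X : 'I_n -> A) (d : 'I_n -> A -> A) (val : A -> K).

Hypothesis charK0 : [pchar K] =i pred0.
Hypothesis dd : forall i, is_derivation (d i).
Hypothesis dX : forall i k, d i (X k) = (i == k)%:R.
Hypothesis valP : is_residue_map val.
Hypothesis valX : forall k, val (X k) = 0.
Hypothesis divX : divides_with_remainder X.

Definition finite_colength (I : set A) :=
  exists D, forall m (g : 'I_m -> A), free_mod I g -> (m <= D)%N.

Variables (J : set A) (f : A).
Hypothesis idJ : is_ideal J.
Hypothesis dfJ : forall i, J (d i f).
Hypothesis valf : val f = 0.

(** The ideal [J + (f ^+ N)]. *)
Definition add_power N : set A := fun x => exists a, J (x - f ^+ N * a).

Lemma add_power_ideal N : is_ideal (add_power N).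
Proof.
have [J0 JD JM] := idJ; split=> [|x y [a Ja] [b Jb]|c x [a Ja]].
- by exists 0; rewrite mulr0 subr0.
- by exists (a + b); have := JD _ _ Ja Jb; congr (J _); ring.
- by exists (c * a); have := JM c _ Ja; congr (J _); ring.
Qed.

Lemma add_power_sub N x : J x -> add_power N x.
Proof. by move=> Jx; exists 0; rewrite mulr0 subr0. Qed.

Lemma add_powerS N x : add_power N.+1 x -> add_power N x.
Proof. by move=> [a Ja]; exists (f * a); rewrite mulrA -exprSr. Qed.

Lemma add_power_mul N x : add_power N x -> add_power N.+1 (f * x).
Proof.
move=> [a Ja]; have [_ _ JM] := idJ; exists a.
by have := JM f _ Ja; congr (J _); rewrite exprS; ring.
Qed.

Lemma add_power_exp N M x : (N <= M)%N -> add_power N (f ^+ M * x).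
Proof.
move=> leNM; have [J0 _ _] := idJ; exists (f ^+ (M - N) * x).
by rewrite mulrA -exprD subnKC // subrr.
Qed.

(** Let [B] be the quotient by [J]. The dimension of [f^N B / f^(N+1) B] is a
    nonincreasing function of [N], because multiplication by [f] maps each of
    these spaces onto the next one; where the least value is reached, this map
    is bijective. *)
Lemma stable_level : finite_colength (add_power 1) ->
  exists N e (h : 'I_e -> A),
   [/\ free_mod (add_power N.+1) (fun i => f ^+ N * h i),
       free_mod (add_power N.+2) (fun i => f ^+ N.+1 * h i) &
       forall x, exists a : 'I_e -> K,
         add_power N.+1 (f ^+ N * x - \sum_i a i *: (f ^+ N * h i))].
Proof.
move=> [D leD].
pose P N m := exists h : 'I_m -> A,
  free_mod (add_power N.+1) (fun i => f ^+ N * h i).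
have free_pred N m (h : 'I_m -> A) :
    free_mod (add_power N.+2) (fun i => f ^+ N.+1 * h i) ->
  free_mod (add_power N.+1) (fun i => f ^+ N * h i).
  move=> freeh a Ua; apply: freeh; have := add_power_mul Ua; congr add_power.
  rewrite mulr_sumr; apply: eq_bigr => i _.
  by rewrite -scalerAr exprS mulrA.
have P_pred N m : P N.+1 m -> P N m by move=> [h /free_pred]; exists h.
pose Q e := `[< exists N, forall m, P N m -> (m <= e)%N >].
have exQ : exists e, Q e.
  exists D; apply/asboolP; exists 0%N => m [h freeh]; apply: (leD m h).
  by move=> a Ua; apply: freeh; move: Ua; congr add_power;
     apply: eq_bigr => i _; rewrite expr0 mul1r.
(* The least bound valid at some level is the eventual dimension. *)
case: (ex_minnP exQ) => e /asboolP[N maxN] mine.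
have [h freeh] : P N.+1 e.
  case: e => [|e] in maxN mine *.
    by exists (fun _ => 0) => a _ [].
  have /asboolPn/forallNP/(_ N.+1)/existsNP[m /not_implyP[Pm /negP]] : ~~ Q e.
    by apply/negP => /mine; rewrite ltnn.
  rewrite -ltnNge => lt_em; have /eqP <- // : m == e.+1.
  by rewrite eqn_leq lt_em maxN //; apply: P_pred.
exists N, e, h; split=> //; first exact: free_pred.
move=> x; apply: (maximal_free_spans (ideal_subspace (add_power_ideal _))
                    (W := fun y => exists z, y = f ^+ N * z)).
- by move=> i; exists (h i).
- exact: free_pred.
- move=> g' /choice[k g'E] freeg'.
  have /maxN : P N e.+1.
    by exists k; rewrite (_ : (fun _ => _) = g') //; apply/funext => i.
  by rewrite ltnn.
- by exists x.
Qed.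

(** The infinitesimal part of the action of [f] is the identity, of trace [e];
    but the trace formula expresses this trace through the partial derivatives
    of [f], which act as zero. *)
Lemma stable_rank0 N e (h : 'I_e -> A) :
    free_mod (add_power N.+1) (fun i => f ^+ N * h i) ->
    free_mod (add_power N.+2) (fun i => f ^+ N.+1 * h i) ->
    (forall x, exists a : 'I_e -> K,
       add_power N.+1 (f ^+ N * x - \sum_i a i *: (f ^+ N * h i))) ->
  e = 0%N.
Proof.
case: e h => [//|e] h free1 free2 spanh; exfalso.
pose w i := f ^+ N * h i.
have idU := add_power_ideal N.+2; have [U0 UD UM] := idU.
have freew (p q : 'I_e.+1 -> K) :
    add_power N.+2 (\sum_k p k *: w k + f * \sum_k q k *: w k) ->
  forall k, p k = 0 /\ q k = 0.
  have fqE : f * (\sum_k q k *: w k) = \sum_k q k *: (f ^+ N.+1 * h k).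
    rewrite mulr_sumr; apply: eq_bigr => k _.
    by rewrite -scalerAr mulrA -exprS.
  have fqE' : f * (\sum_k q k *: w k) = f ^+ N.+1 * \sum_k q k *: h k.
    by rewrite fqE mulr_sumr; apply: eq_bigr => k _; rewrite scalerAr.
  move=> Upq; have p0 : forall k, p k = 0.
    apply: free1; have := idealB (add_power_ideal N.+1) (add_powerS Upq)
      (add_power_exp (\sum_k q k *: h k) (leqnn N.+1)).
    by rewrite fqE' addrK.
  have q0 : forall k, q k = 0.
    apply: free2; rewrite -fqE; move: Upq.
    by rewrite big1 ?add0r // => k _; rewrite p0 scale0r.
  by move=> k; rewrite p0 q0.
have f2w i : add_power N.+2 (f * f * w i).
  have := add_power_exp (h i) (leqnn N.+2); congr add_power.
  by rewrite !exprS /w; ring.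
(* Spanning at the level N is used twice: for f ^+ N * x, and for the term
   f ^+ N.+1 * y that it leaves. *)
have span2 x : exists pq : ('I_e.+1 -> K) * ('I_e.+1 -> K), add_power N.+2
    (f ^+ N * x - (\sum_k pq.1 k *: w k + f * \sum_k pq.2 k *: w k)).
  have [p [y Jy]] := spanh x; have [q [z Jz]] := spanh y.
  exists (p, q), z; have [_ JD JM] := idJ.
  have := JD _ _ Jy (JM f _ Jz); congr (J _); rewrite /= /w.
  set sp := \sum_k p k *: _; set sq := \sum_k q k *: _.
  by rewrite !exprS; ring.
have /choice[act actP] : forall g, exists PQ : 'M[K]_e.+1 * 'M[K]_e.+1,
    acts_by (add_power N.+2) w f g PQ.1 PQ.2.
  move=> g; have /choice[pq pqP] := fun i => span2 (g * h i).
  exists (\matrix_(i, k) (pq i).1 k, \matrix_(i, k) (pq i).2 k) => i.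
  have := pqP i; congr add_power; rewrite /w mulrCA; congr (_ - (_ + _ * _)).
    by apply: eq_bigr => k _; rewrite mxE.
  by apply: eq_bigr => k _; rewrite mxE.
pose rho g := (act g).1; pose delta g := (act g).2.
have act_eq g P Q : acts_by (add_power N.+2) w f g P Q ->
    rho g = P /\ delta g = Q.
  exact: acts_by_unique (actP g).
have actL a x y := act_eq _ _ _
  (acts_byD idU (acts_byZ idU a (actP x)) (actP y)).
have actM x y := act_eq _ _ _ (acts_byM idU f2w (actP x) (actP y)).
have := trace_delta (delta := delta) dd dX valP valX divX
  (fun a x y => (actL a x y).1) (fun a x y => (actL a x y).2)
  (act_eq _ _ _ (acts_by1 _ _ idU)).1
  (fun x y => (actM x y).1) (fun x y => (actM x y).2) f.
rewrite (act_eq _ _ _ (acts_by_self _ _ idU)).2 mxtrace1 big1 => [|i _].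
  by apply/eqP; rewrite (pcharf0P K).1.
rewrite (act_eq _ _ _ (acts_by_ideal w f idU (add_power_sub _ (dfJ i)))).1.
by rewrite mul0mx mxtrace0.
Qed.

Lemma nilpotent_mod_ideal : finite_colength (add_power 1) ->
  exists N, J (f ^+ N).
Proof.
move=> /stable_level[N [e [h [free1 free2 spanh]]]].
have e0 := stable_rank0 free1 free2 spanh; exists N.
subst e; have [a] := spanh 1; rewrite big_ord0 mulr1 subr0.
move=> -[b Jb]; have [valL valM val1 val_unit] := valP.
have [_ _ JM] := idJ.
have [c fbc] : exists c, (1 - f * b) * c = 1.
  apply: val_unit.
  have -> : 1 - f * b = (-1) *: (f * b) + 1 by rewrite scaleN1r addrC.
  by rewrite valL valM valf mul0r mulr0 add0r val1 oner_neq0.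
have := JM c _ Jb; congr (J _); rewrite -[RHS]mulr1 -fbc exprSr; ring.
Qed.

Lemma finite_colength_spans (I : set A) : is_ideal I -> finite_colength I ->
  exists m (g : 'I_m -> A),
    forall x, exists a : 'I_m -> K, I (x - \sum_i a i *: g i).
Proof.
move=> idI [D leD].
pose P m := `[< exists g : 'I_m -> A, free_mod I g >].
have P0 : exists m, P m.
  by exists 0%N; apply/asboolP; exists (fun _ => 0) => a _ [].
have leP m : P m -> (m <= D)%N by move=> /asboolP[g]; apply: leD.
case: (ex_maxnP P0 leP) => m /asboolP[g freeg] maxm; exists m, g => x.
apply: (maximal_free_spans (ideal_subspace idI) (W := setT)) => //.
move=> g' _ freeg'; have /maxm : P m.+1 by apply/asboolP; exists g'.
by rewrite ltnn.
Qed.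

Lemma add_power_spans N : finite_colength (add_power 1) ->
  exists m (g : 'I_m -> A),
    forall x, exists a : 'I_m -> K, add_power N (x - \sum_i a i *: g i).
Proof.
move=> /(finite_colength_spans (add_power_ideal 1))[t [h spanh]].
have [J0 JD JM] := idJ.
elim: N => [|N [m [g spang]]].
  exists 0%N, (fun _ => 0) => x; exists (fun _ => 0); exists x.
  by rewrite big_ord0 subr0 expr0 mul1r subrr.
exists (m + t)%N, (fun i => match split i with
  inl k => g k | inr k => f ^+ N * h k end) => x.
have [a [y Jy]] := spang x; have [b [z Jz]] := spanh y.
exists (fun i => match split i with inl k => a k | inr k => b k end), z.
have := JD _ _ Jy (JM (f ^+ N) _ Jz); congr (J _).
have splitl k : split (lshift t k) = inl k := unsplitK (inl k : 'I_m + 'I_t).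
have splitr k : split (rshift m k) = inr k := unsplitK (inr k : 'I_m + 'I_t).
rewrite big_split_ord /=.
under [X in _ = _ - (X + _) - _]eq_bigr do rewrite splitl.
under [X in _ = _ - (_ + X) - _]eq_bigr do rewrite splitr scalerAr.
by rewrite -mulr_sumr expr1 exprS; ring.
Qed.

(** Once [f] is nilpotent modulo [J], the powers of [f] times finitely many
    elements spanning the quotient by [J] and [f] span the quotient by [J]. *)
Lemma finite_colength_add1 :
  finite_colength (add_power 1) -> finite_colength J.
Proof.
move=> fin1; have [N JfN] := nilpotent_mod_ideal fin1.
have [D [h spanh]] := add_power_spans N fin1; exists D => m g freeg.
refine (free_mod_leq_span (ideal_subspace idJ) _ freeg) => x.
have [a [y Jy]] := spanh x; exists a; have [_ JD JM] := idJ.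
by have := JD _ _ Jy (JM y _ JfN); congr (J _); ring.
Qed.

End FiniteColength.

(** * Formal power series *)

Section FormalSeries.
Variables (n : nat) (K : fieldType).
Implicit Types (f g h y : fps n K) (m u : multinom n).

Lemma coef_fpsD f g m : (f + g) m = f m + g m. Proof. by []. Qed.
Lemma coef_fpsN f m : (- f) m = - f m. Proof. by []. Qed.
Lemma coef_fps1 m : (1 : fps n K) m = (m == mnm0)%:R. Proof. by []. Qed.

Lemma coef_fps_sum (I : Type) (r : seq I) (P : pred I) (F : I -> fps n K) m :
  (\sum_(i <- r | P i) F i) m = \sum_(i <- r | P i) F i m.
Proof. by elim/big_rec2: _ => // i y x _ <-. Qed.

Lemma coef_fpsM_trunc d f g m : (mdeg m < d)%N ->
  (f * g) m = mcoeff m (fps_trunc d f * fps_trunc d g).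
Proof. exact: fps_mulE. Qed.

Lemma coef_fpsM d f g m : (mdeg m < d)%N ->
  (f * g) m = \sum_(k : bmultinom n d * bmultinom n d
                   | m == mnm_add k.1 k.2) f k.1 * g k.2.
Proof.
move=> md; rewrite (coef_fpsM_trunc _ _ md) (mcoeff_poly_mul _ _ md).
by apply: eq_bigr => k _; rewrite !mcoeff_fps_trunc ?bmdeg.
Qed.

Lemma eq_coef_fpsM d f g g' m : (mdeg m < d)%N ->
  (forall k, (mdeg k < d)%N -> g k = g' k) -> (f * g) m = (f * g') m.
Proof.
move=> md gg'; rewrite !(coef_fpsM _ _ md).
by apply: eq_bigr => k _; rewrite gg' ?bmdeg.
Qed.

Lemma coef0_fpsM f g : (f * g) mnm0 = f mnm0 * g mnm0.
Proof.
have lt01 : (mdeg (@mnm0 n) < 1)%N by rewrite mdeg0.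
by rewrite (coef_fpsM_trunc _ _ lt01) rmorphM /= !mcoeff_fps_trunc.
Qed.

Definition fps_monomial u : fps n K := Fps (fun m => (m == u)%:R).

Lemma coef_fps_monomialM u h m :
  (fps_monomial u * h) m = if lem u m then h (mnm_sub m u) else 0.
Proof.
rewrite (coef_fpsM _ _ (ltnSn (mdeg m))); case: ifPn => [le_um|nle_um].
- have umE : mnm_add u (mnm_sub m u) = m by rewrite addmC submK.
  have degE : (mdeg u + mdeg (mnm_sub m u))%N = mdeg m by rewrite -mdegD umE.
  have ltu : (mdeg u < (mdeg m).+1)%N by rewrite ltnS -degE leq_addr.
  have ltmu : (mdeg (mnm_sub m u) < (mdeg m).+1)%N.
    by rewrite ltnS -degE leq_addl.
  rewrite (bigD1 (BMultinom ltu, BMultinom ltmu)) /=; last by rewrite umE.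
  rewrite eqxx mul1r big1 ?addr0 // => -[k1 k2] /= /andP[/eqP mE].
  case: (eqVneq (bmnm k1) u) => [k1u|]; last by rewrite mul0r.
  move=> /eqP[]; congr (_, _); apply: val_inj => //.
  by apply: (@addmI n u); transitivity m => //; rewrite -k1u.
- rewrite big1 // => -[k1 k2] /= /eqP mE.
  case: (eqVneq (bmnm k1) u) => [k1u|]; last by rewrite mul0r.
  by case/negP: nle_um; rewrite mE k1u lem_addr.
Qed.

Lemma fps_monomialD u u' :
  fps_monomial (mnm_add u u') = fps_monomial u * fps_monomial u'.
Proof.
apply: fpsP => m; rewrite coef_fps_monomialM /=.
case: ifPn => [le_um|nle_um].
  rewrite -(eqm_add2l u (mnm_sub m u) u').
  by rewrite [mnm_add u (mnm_sub m u)]addmC submK.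
case: eqP => // mE; case/negP: nle_um; rewrite mE; exact: lem_addr.
Qed.

Lemma fps_monomial_exp u s :
  fps_monomial (mnm_muln u s) = fps_monomial u ^+ s.
Proof.
elim: s => [|s IHs]; first by rewrite mulm0n; apply: fpsP.
by rewrite mulmS fps_monomialD IHs exprS.
Qed.

Lemma fps_monomialE u :
  fps_monomial u = \prod_i fps_monomial (mnm1 i) ^+ u i.
Proof.
rewrite {1}[u]multinomUE_id; under [RHS]eq_bigr do rewrite -fps_monomial_exp.
by apply: (big_morph _ fps_monomialD); apply: fpsP.
Qed.

Lemma fps_derivM i f g :
  fps_deriv i (f * g) = fps_deriv i f * g + f * fps_deriv i g.
Proof.
apply: fpsP => m; set d := (mdeg m).+1.
have md : (mdeg m < d)%N by [].
have mdS : (mdeg (mnm_add m (mnm1 i)) < d.+1)%N by rewrite mdegD mdeg1 addn1.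
have derivE h k : (mdeg k < d)%N ->
    mcoeff k (mderiv i (fps_trunc d.+1 h)) = fps_deriv i h k.
  move=> kd; rewrite mcoeff_mderiv mcoeff_fps_trunc; last first.
    by rewrite mdegD mdeg1 addn1.
  by rewrite [RHS]/= mulr_natl.
transitivity ((m i).+1%:R * (f * g) (mnm_add m (mnm1 i))) => //.
rewrite (coef_fpsM_trunc _ _ mdS) mulr_natl -mcoeff_mderiv mderivM.
rewrite mcoeffD coef_fpsD !(coef_fpsM_trunc _ _ md).
congr (_ + _); apply: (eq_mcoeffM md) => k kd.
- by rewrite derivE // mcoeff_fps_trunc.
- by rewrite !mcoeff_fps_trunc // ltnW.
- by rewrite !mcoeff_fps_trunc // ltnW.
- by rewrite derivE // mcoeff_fps_trunc.
Qed.

Lemma fps_derivX i k : fps_deriv i (fps_monomial (mnm1 k)) = (i == k)%:R.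
Proof.
apply: fpsP => m /=; case: (eqVneq i k) => [->|ik].
  rewrite -{2}[mnm1 k]add0m eqm_add2r mulr1n coef_fps1.
  case: (eqVneq m mnm0) => [->|_]; last by rewrite mulr0.
  by rewrite mnm0E mulr1.
case: eqP => [/(congr1 (fun u : multinom n => u i))|_]; last by rewrite mulr0.
by rewrite mnmDE !mnm1E eqxx eq_sym (negbTE ik) addn1.
Qed.

(** This makes the geometric series a finite sum in each degree. *)
Lemma coef_fps_exp_eq0 y k m :
  y mnm0 = 0 -> (mdeg m < k)%N -> (y ^+ k) m = 0.
Proof.
move=> y0; elim: k m => [|k IHk] m // mk.
rewrite exprS (coef_fpsM _ _ (ltnSn _)) big1 // => -[k1 k2] /= /eqP mE.
case: (eqVneq (bmnm k1) mnm0) => [->|nzk1]; first by rewrite y0 mul0r.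
rewrite (IHk k2) ?mulr0 //; rewrite -mdeg_eq0 -lt0n in nzk1.
by have := congr1 (@mdeg n) mE; rewrite mdegD; lia.
Qed.

Definition fps_geometric y : fps n K :=
  Fps (fun m => \sum_(k < (mdeg m).+1) (y ^+ k) m).

Lemma fps_geometricP y : y mnm0 = 0 -> (1 - y) * fps_geometric y = 1.
Proof.
move=> y0; apply: fpsP => m; set d := (mdeg m).+1.
have md : (mdeg m < d)%N by [].
rewrite (eq_coef_fpsM (g' := \sum_(k < d) y ^+ k) _ md) => [|k kd].
  have -> : (1 - y) * (\sum_(k < d) y ^+ k) = 1 - y ^+ d.
    by rewrite -opprB mulNr -subrX1 opprB.
  by rewrite coef_fpsD coef_fpsN coef_fps_exp_eq0 // subr0.
rewrite coef_fps_sum /= (big_ord_widen d (fun i => (y ^+ i) k)) //.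
rewrite [RHS](bigID (fun i : 'I_d => (i < (mdeg k).+1)%N)) /=.
rewrite [X in _ = _ + X]big1 ?addr0 // => i; rewrite -leqNgt => lt_ki.
exact: coef_fps_exp_eq0.
Qed.

End FormalSeries.

(** * Convergent power series *)

Section WeightedNorm.
Variables (R : realType) (K : fieldType) (v : absval R K) (n : nat).
Implicit Types (f g h y : fps n K) (m u : multinom n) (r : R) (d : nat).

Definition trunc_norm r d f : R :=
  \sum_(m : bmultinom n d) v (f m) * r ^+ mdeg m.

Lemma trunc_norm_ge0 r d f : 0 <= r -> 0 <= trunc_norm r d f.
Proof.
by move=> r0; apply: sumr_ge0 => m _; rewrite mulr_ge0 ?absv_ge0 ?exprn_ge0.
Qed.

Lemma trunc_normD r d f g : 0 <= r ->
  trunc_norm r d (f + g) <= trunc_norm r d f + trunc_norm r d g.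
Proof.
move=> r0; rewrite -big_split; apply: ler_sum => m _ /=.
by rewrite -mulrDl ler_wpM2r ?exprn_ge0 ?absv_leD.
Qed.

Lemma trunc_normM r d f g : 0 <= r ->
  trunc_norm r d (f * g) <= trunc_norm r d f * trunc_norm r d g.
Proof.
move=> r0; pose F h m := v (h m) * r ^+ mdeg m.
have F0 h m : 0 <= F h m by rewrite mulr_ge0 ?absv_ge0 ?exprn_ge0.
have le_coef (m : bmultinom n d) : F (f * g) m <=
    \sum_(k : bmultinom n d * bmultinom n d | bmnm m == mnm_add k.1 k.2)
      F f k.1 * F g k.2.
  rewrite /F (coef_fpsM _ _ (bmdeg m)).
  apply: le_trans (ler_wpM2r (exprn_ge0 _ r0) (absv_sum v _ _ _)) _.
  rewrite mulr_suml; apply: ler_sum => k /eqP ->.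
  by rewrite mdegD exprD absvM mulrACA.
apply: (@le_trans _ _ (\sum_(m : bmultinom n d)
    \sum_(k : bmultinom n d * bmultinom n d | bmnm m == mnm_add k.1 k.2)
      F f k.1 * F g k.2)); first by apply: ler_sum => m _; exact: le_coef.
rewrite (exchange_big_dep xpredT) //= [leRHS]big_distrlr pair_bigA /=.
apply: ler_sum => -[k1 k2] _ /=.
have [m /eqP mE|none] :=
  pickP (fun m : bmultinom n d => bmnm m == mnm_add k1 k2).
  by rewrite (big_pred1 m) // => m' /=; rewrite -mE -val_eqE.
by rewrite big_pred0 // mulr_ge0 ?F0.
Qed.

Lemma trunc_norm_monomial r d u : 0 <= r ->
  trunc_norm r d (fps_monomial K u) <= r ^+ mdeg u.
Proof.
move=> r0; have [ud|du] := ltnP (mdeg u) d; last first.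
  rewrite /trunc_norm big1 ?exprn_ge0 // => m _ /=.
  case: eqP => [mu|_]; last by rewrite absv0 mul0r.
  by have := bmdeg m; rewrite mu ltnNge du.
rewrite /trunc_norm (bigD1 (BMultinom ud)) //= big1 => [|m].
  by rewrite eqxx absv1 mul1r addr0.
by rewrite -val_eqE /= => /negbTE ->; rewrite absv0 mul0r.
Qed.

Lemma convergent_monomial u : convergent v (fps_monomial K u).
Proof.
apply/convergentP; exists 1, 1; split=> // d.
by have := trunc_norm_monomial d u (@ler01 R); rewrite expr1n.
Qed.

Lemma convergent_shift u f h : convergent v f ->
  (forall m, v (h m) <= v (f (mnm_add m u))) -> convergent v h.
Proof.
move=> /convergentP[r [M [r0 M0 leM]]] le_hf; apply/convergentP.
have ru0 : 0 < r ^+ mdeg u by rewrite exprn_gt0.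
exists r, ((r ^+ mdeg u)^-1 * M); split=> //.
  by rewrite mulr_ge0 // invr_ge0 ltW.
move=> d; rewrite ler_pdivlMl //; apply: le_trans (leM (d + mdeg u)%N).
pose F m := v (f m) * r ^+ mdeg m.
have F0 m : 0 <= F m by rewrite mulr_ge0 ?absv_ge0 ?exprn_ge0 ?ltW.
pose s := [seq mnm_add (bmnm m) u | m : bmultinom n d].
apply: (@le_trans _ _ (\sum_(m <- s) F m)).
  rewrite big_image mulr_sumr; apply: ler_sum => m _.
  rewrite /F mdegD exprD mulrCA [r ^+ mdeg m * _]mulrC.
  by rewrite ler_wpM2r // mulr_ge0 ?exprn_ge0 ?ltW.
apply: bmultinom_leq_sum => //.
  rewrite map_inj_uniq ?enum_uniq // => m m' /addIm mm'; exact: val_inj.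
by move=> _ /mapP[m _ ->]; rewrite mdegD ltn_add2r bmdeg.
Qed.

(** Shrinking the radius by a factor [t] multiplies every term of positive
    degree by at most [t]. *)
Lemma convergent_small y : convergent v y -> y mnm0 = 0 ->
  exists2 r, 0 < r & forall d, trunc_norm r d y <= 2^-1.
Proof.
move=> /convergentP[r [M [r0 M0 leM]]] y0.
have M1 : 0 < M + 1 by lra.
pose t := (2 * (M + 1))^-1.
have t0 : 0 < t by rewrite invr_gt0 mulr_gt0.
have t1 : t <= 1 by rewrite invf_le1 ?mulr_gt0 //; lra.
exists (r * t) => [|d]; first exact: mulr_gt0.
apply: (@le_trans _ _ (t * M)); last first.
  by rewrite /t invfM -mulrA ler_piMr // ?invr_ge0 // mulrC ler_pdivrMr; lra.
apply: le_trans (ler_wpM2l (ltW t0) (leM d)); rewrite mulr_sumr.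
apply: ler_sum => m _; rewrite mulrCA.
case: (eqVneq (bmnm m) mnm0) => [->|nzm]; first by rewrite y0 absv0 !mul0r.
rewrite ler_wpM2l ?absv_ge0 // exprMn mulrC.
apply: ler_wpM2r; first by rewrite exprn_ge0 ?ltW.
rewrite -mdeg_eq0 -lt0n in nzm.
by rewrite -(prednK nzm) exprS ler_piMr ?exprn_ile1 // ltW.
Qed.

(** The inverse [z] of [1 - y] satisfies [z = 1 + y * z], so [||z|| <= 1 +
    ||z|| / 2] at a radius where [||y|| <= 1 / 2]. *)
Lemma convergent_geometric y : convergent v y -> y mnm0 = 0 ->
  convergent v (fps_geometric y).
Proof.
move=> cy y0; have [r r0 le_y] := convergent_small cy y0.
have zE : fps_geometric y = 1 + y * fps_geometric y.
  have := fps_geometricP y0; rewrite mulrBl mul1r => <-.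
  by rewrite subrK.
apply/convergentP; exists r, 2; split=> // d.
rewrite -/(trunc_norm r d (fps_geometric y)).
have r0' := ltW r0; set z := fps_geometric y in zE *.
have := trunc_normD d 1 (y * z) r0'; rewrite -zE.
have := trunc_norm_monomial d mnm0 r0'; rewrite mdeg0 expr0.
rewrite -/(1 : fps n K); have := trunc_normM d y z r0'.
have := ler_wpM2r (trunc_norm_ge0 d z r0') (le_y d); lra.
Qed.

End WeightedNorm.

Section ConvergentSeriesRing.
Variables (R : realType) (K : fieldType) (v : absval R K) (n : nat).

HB.instance Definition _ := GRing.Lalgebra_isComAlgebra.Build K (cps v n).

Definition cps_coord (k : 'I_n) : cps v n :=
  Cps (introT (conv_predP v _) (convergent_monomial v (mnm1 k))).

Lemma value0_residue_map : is_residue_map (@value0 R K v n).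
Proof.
split=> // [x y||x nz_x]; first exact: coef0_fpsM.
  by rewrite /value0 /= eqxx.
pose c := value0 x.
(* Dividing by the constant term c turns x into 1 - y with y 0 = 0. *)
pose y : cps v n := 1 - c^-1 *: x.
have y0 : fps_coef y mnm0 = 0.
  by rewrite -[LHS]/((1 : fps n K) mnm0 - c^-1 * c) coef_fps1 eqxx mulVf ?subrr.
have cz := convergent_geometric (elimT (conv_predP v _) (valP y)) y0.
exists (c^-1 *: (Cps (introT (conv_predP v _) cz))).
apply: val_inj; rewrite -[RHS](fps_geometricP y0) -scalerAr scalerAl.
congr (_ * _); rewrite -[LHS]/(val (c^-1 *: x)).
by rewrite -[RHS]/(val (1 - y)) /y opprB addrC subrK.
Qed.

Lemma cps_deriv_derivation i : is_derivation (@cps_deriv R K v n i).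
Proof.
split=> [a x y|x y]; apply: val_inj; last exact: fps_derivM.
by apply: fpsP => m; rewrite /= mulrDr mulrCA.
Qed.

Lemma cps_deriv_coord i k : cps_deriv i (cps_coord k) = (i == k)%:R.
Proof.
by apply: val_inj; rewrite [LHS]fps_derivX; case: (i == k).
Qed.

Lemma cps_val_sum (I : Type) (r : seq I) (F : I -> cps v n) :
  cps_val (\sum_(i <- r) F i) = \sum_(i <- r) cps_val (F i).
Proof. by elim/big_rec2: _ => // i y x _ <-. Qed.

Lemma cps_val_prod (I : Type) (r : seq I) (F : I -> cps v n) :
  cps_val (\prod_(i <- r) F i) = \prod_(i <- r) cps_val (F i).
Proof. by elim/big_rec2: _ => // i y x _ <-. Qed.

Lemma cps_val_exp (x : cps v n) s : cps_val (x ^+ s) = cps_val x ^+ s.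
Proof. by elim: s => // s IHs; rewrite !exprS -IHs. Qed.

(** A monomial that is not bounded by [s] in every variable is attributed to
    one variable whose exponent reaches [s]. *)
Lemma cps_division : divides_with_remainder cps_coord.
Proof.
move=> s g; pose large (m : multinom n) := [pick k | (s <= m k)%N].
pose u k : multinom n := mnm_muln (mnm1 k) s.
have hP k : exists h : cps v n, forall m, fps_coef h m =
    if large (mnm_add m (u k)) == Some k then g (mnm_add m (u k)) else 0.
  have ch : convergent v (Fps (fun m =>
      if large (mnm_add m (u k)) == Some k then g (mnm_add m (u k)) else 0)).
    apply: (convergent_shift (u := u k) (elimT (conv_predP v _) (valP g))).
    by move=> m /=; case: ifP => // _; rewrite absv0 absv_ge0.
  by exists (Cps (introT (conv_predP v _) ch)).
have /choice[h hE] := hP.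
pose d := (n * s).+1.
exists [seq bmnm m | m : bmultinom n d].
exists (fun m => if large m is None then g m else 0), h.
have prodE (m : multinom n) :
    cps_val (\prod_i cps_coord i ^+ m i) = fps_monomial K m.
  rewrite cps_val_prod fps_monomialE; apply: eq_bigr => i _.
  by rewrite cps_val_exp.
have powE k : cps_val (cps_coord k ^+ s) = fps_monomial K (u k).
  by rewrite cps_val_exp fps_monomial_exp.
set p := \sum_(m <- _) _; set q := \sum_k _.
apply: val_inj; rewrite -[RHS]/(cps_val p + cps_val q) !cps_val_sum big_image.
apply: fpsP => m; rewrite coef_fpsD !coef_fps_sum.
have -> : \sum_(k < n) (cps_val (cps_coord k ^+ s * h k)) m =
    if large m is None then 0 else g m.
  transitivity (\sum_(k < n) if large m == Some k then g m else 0).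
    apply: eq_bigr => k _.
    rewrite -[cps_val _]/(cps_val (cps_coord k ^+ s) * cps_val (h k)) powE.
    rewrite coef_fps_monomialM; case: ifPn => [le_um|nle_um].
      by rewrite hE submK.
    rewrite /large; case: pickP => [l le_sl|//]; case: eqP => // -[lk].
    case/negP: nle_um; apply/mnm_lepP => i; rewrite mulmnE mnm1E -lk.
    by case: eqP => [<-|//]; rewrite mul1n.
  case: (large m) => [l|]; last by rewrite big1.
  rewrite (bigD1 l) //= eqxx big1 ?addr0 // => k nkl.
  by case: (Some l =P Some k) => // -[lk]; rewrite lk eqxx in nkl.
have -> : \sum_(k : bmultinom n d) cps_val
    ((if large k is None then g k else 0) *: \prod_i cps_coord i ^+ k i) m =
    if large m is None then g m else 0.
  pose c k := if large k is None then g k else 0; rewrite -/(c m).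
  transitivity (\sum_(k : bmultinom n d) if m == bmnm k then c m else 0).
    apply: eq_bigr => k _; rewrite -[LHS]/(c k * cps_val _ m) prodE /=.
    by case: eqP => [->|_]; rewrite ?mulr1 ?mulr0.
  have [md|dm] := ltnP (mdeg m) d.
    rewrite (bigD1 (BMultinom md)) //= eqxx big1 ?addr0 // => k.
    by rewrite -val_eqE eq_sym => /negbTE /= ->.
  rewrite big1 => [|k _]; last first.
    by case: eqP => // mk; have := bmdeg k; rewrite -mk ltnNge dm.
  rewrite /c /large; case: pickP => // small; move: dm; rewrite ltnNge.
  have le_ms i : (m i <= s)%N by rewrite ltnW // ltnNge small.
  rewrite mdegE (@leq_trans (\sum_(i < n) s)%N) //; first exact: leq_sum.
  by rewrite sum_nat_const card_ord.
by case: (large m) => [l|]; rewrite ?addr0 ?add0r.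
Qed.

End ConvergentSeriesRing.

Lemma ideal_gen_is_ideal (K : fieldType) (A : comAlgType K) (s : seq A) :
  is_ideal (ideal_gen s).
Proof.
split=> [|x y [a ->] [b ->]|c x [a ->]].
- by exists (fun=> 0); rewrite big1 // => i _; rewrite mul0r.
- exists (fun i => a i + b i); rewrite -big_split.
  by apply: eq_bigr => i _; rewrite mulrDl.
- exists (fun i => c * a i); rewrite mulr_sumr.
  by apply: eq_bigr => i _; rewrite mulrA.
Qed.

(** * Milnor and Tjurina numbers *)

Lemma ideal_gen_mem (A : comNzRingType) (s : seq A) x :
  x \in s -> ideal_gen s x.
Proof.
move=> /(nthP 0)[k lt_ks <-]; exists (fun i => (i == Ordinal lt_ks)%:R).
rewrite (bigD1 (Ordinal lt_ks)) //= eqxx mul1r big1 ?addr0 // => i.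
by move=> /negbTE ->; rewrite mul0r.
Qed.

Lemma ideal_gen_cons (A : comNzRingType) (f : A) (s : seq A) x :
  ideal_gen (f :: s) x <-> exists a, ideal_gen s (x - f * a).
Proof.
split=> [[c ->]|[a [c xE]]].
  exists (c ord0); exists (fun i => c (lift ord0 i)).
  by rewrite big_ord_recl /= mulrC addrC addKr.
exists (fun i => if unlift ord0 i is Some k then c k else a).
rewrite big_ord_recl unlift_none /= mulrC -[LHS](subrK (f * a)) xE addrC.
by congr (_ + _); apply: eq_bigr => i _; rewrite liftK.
Qed.

Lemma jacobian_deriv (R : realType) (K : fieldType) (v : absval R K) (n : nat)
    (f : cps v n) i : ideal_gen (jacobian f) (cps_deriv i f).
Proof. by apply: ideal_gen_mem; apply: map_f; rewrite mem_enum. Qed.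

Theorem theorem1p5 (R : realType) (K : fieldType) (v : absval R K)
    (charK0 : [pchar K]%R =i pred0) (n : nat) (f : cps v n) :
  (value0 f = 0%R ->
     ((milnor f < +oo)%E <-> (tjurina f < +oo)%E))
  /\ ((milnor f < +oo)%E -> (tjurina f < +oo)%E).
Proof.
have idJ := ideal_gen_is_ideal (jacobian f); have [J0 _ _] := idJ.
have sub_tjurina x : ideal_gen (jacobian f) x -> ideal_gen (f :: jacobian f) x.
  by move=> Jx; apply/ideal_gen_cons; exists 0; rewrite mulr0 subr0.
have milnor_tjurina : (milnor f < +oo)%E -> (tjurina f < +oo)%E.
  move=> /dim_quot_lty[D leD]; apply/dim_quot_lty; exists D => m g freeg.
  exact: leD (free_mod_subset sub_tjurina freeg).
split=> // f0; split=> // /dim_quot_lty[D leD]; apply/dim_quot_lty.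
apply: (finite_colength_add1 charK0 (@cps_deriv_derivation R K v n)
  (@cps_deriv_coord R K v n) (value0_residue_map v n) _ (@cps_division R K v n)
  idJ (jacobian_deriv f) f0).
  by move=> k; rewrite /value0 /= eq_sym -mdeg_eq0 mdeg1.
exists D => m g freeg; apply: leD; apply: free_mod_subset freeg => x.
by move=> /ideal_gen_cons[a Ja]; exists a; rewrite expr1.
Qed.
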